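(* Let $G=(V,E)$ be a finite undirected graph without self-loops and without multiple edges. For each vertex $p\in V$ define $$K(p) = 1+\sum_{k=1}^{\infty} (-1)^k \frac{V_{k-1}(p)}{k+1},$$ where $V_{j}(p)$ denotes the number of $j$-dimensional simplices in the unit sphere $S_1(p)$ of $p$ (so $K(p)$ depends only on $S_1(p)$). Then $$\sum_{p\in V} K(p) = \chi(G),$$ where $\chi(G)=\sum_{k=0}^{\infty}(-1)^k v_k$ and $v_k$ is the number of $k$-dimensional simplices in $G$.
   Context: A $k$-dimensional simplex of a graph is a complete subgraph $K_{k+1}$ on $k+1$ vertices (equivalently, a set of $k+1$ pairwise adjacent vertices). The unit sphere $S_1(p)$ of a vertex $p$ is the subgraph induced on the set $\{q\in V : (p,q)\in E\}$ of neighbors of $p$. The sums are finite because the graph is finite. *)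

(* Defs.v *)
From mathcomp Require Import all_boot all_order all_algebra.
Set Implicit Arguments.
Unset Strict Implicit.
Unset Printing Implicit Defensive.
Import GRing.Theory.
Local Open Scope ring_scope.

Record sgraph := SGraph {
  vertex :> finType;
  adj : rel vertex;
  adj_sym : symmetric adj;
  adj_irrefl : irreflexive adj
}.

Section Induced.
Variables (G : sgraph) (S : {set G}).

Definition induced_adj : rel {x : G | x \in S} :=
  fun x y => adj (val x) (val y).

Lemma induced_adj_sym : symmetric induced_adj.
Proof. by move=> x y; rewrite /induced_adj adj_sym. Qed.

Lemma induced_adj_irrefl : irreflexive induced_adj.
Proof. by move=> x; rewrite /induced_adj adj_irrefl. Qed.

Definition induced : sgraph := SGraph induced_adj_sym induced_adj_irrefl.

End Induced.

Definition unit_sphere (G : sgraph) (p : G) : sgraph :=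
  induced [set q | adj p q].

(* A k-dimensional simplex has k + 1 vertices; the empty set is not one. *)
Definition simplices (G : sgraph) (k : nat) : {set {set G}} :=
  [set A : {set G} | (#|A| == k.+1) &&
     [forall x in A, forall y in A, (x != y) ==> adj x y]].

Definition num_simplices (G : sgraph) (k : nat) : nat := #|simplices G k|.

(* Justifies the upper bounds of the two sums below: all the omitted terms of
   the infinite sums vanish. *)
Lemma num_simplices_eq0 (G : sgraph) (k : nat) :
  (#|G| <= k)%N -> num_simplices G k = 0%N.
Proof.
move=> leGk; apply/eqP; rewrite cards_eq0; apply/eqP/setP => A.
rewrite !inE; apply/negbTE; rewrite negb_and neq_ltn ltnS.
by rewrite (leq_trans (max_card _) leGk).
Qed.

Definition euler_char (G : sgraph) : int :=
  \sum_(0 <= k < #|G|) (-1) ^+ k * (num_simplices G k)%:Z.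

Definition curvature (G : sgraph) (p : G) : rat :=
  1 + \sum_(1 <= k < #|unit_sphere p|.+1)
        (-1) ^+ k * ((num_simplices (unit_sphere p) k.-1)%:R / k.+1%:R).

(* Main.v *)
Require Import Defs.
From mathcomp Require Import all_boot all_order all_algebra.
Import GRing.Theory.
Local Open Scope ring_scope.

(** Give every simplex [A] of dimension [k] the charge [(-1)^k], so that the
    total charge is the Euler characteristic, and let [A] share its charge
    equally among its [k + 1] vertices. The charge collected by [p] is the
    curvature of [p]: [p] lies in the single 0-simplex [[set p]], which accounts
    for the leading 1, and for [k >= 1] deleting [p] is a bijection from the
    k-simplices through [p] to the (k-1)-simplices of the unit sphere of [p]
    ([card_star], [curvatureE]). Summing over [p] recovers the total charge by
    counting the incident pairs (vertex, k-simplex) in two ways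
    ([sum_card_star]). *)

Definition star (G : sgraph) (k : nat) (p : G) : {set {set G}} :=
  [set A in simplices G k | p \in A].

Lemma simplicesP (G : sgraph) (k : nat) (A : {set G}) :
  reflect (#|A| = k.+1 /\ {in A &, forall x y, x != y -> adj x y})
          (A \in simplices G k).
Proof.
rewrite inE; apply: (iffP andP) => [[/eqP-> cliqueA]|[-> cliqueA]]; split=> //.
  move=> x y Ax Ay; apply/implyP.
  by move/forall_inP: cliqueA => /(_ x Ax)/forall_inP/(_ y Ay).
apply/forall_inP => x Ax; apply/forall_inP => y Ay.
by apply/implyP; apply: cliqueA.
Qed.

Lemma star0 (G : sgraph) (p : G) : star G 0 p = [set [set p]].
Proof.
apply/setP => A; rewrite !inE -andbA; apply/and3P/eqP => [[/cards1P[x ->] _]|->].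
  by rewrite inE => /eqP->.
rewrite cards1 set11; split=> //.
by apply/forall_inP => x /set1P->; apply/forall_inP => y /set1P->; rewrite eqxx.
Qed.

(** The cone [p |: B] over a simplex [B] of the unit sphere is a simplex through
    [p], and every simplex through [p] with at least two vertices is the cone
    over exactly one such [B], its face opposite to [p]. *)
Lemma card_star (G : sgraph) (k : nat) (p : G) :
  #|star G k.+1 p| = num_simplices (unit_sphere p) k.
Proof.
set S := unit_sphere p; pose cone (B : {set S}) : {set G} := p |: val @: B.
have adj_p (x : S) : adj p (val x) by have := valP x; rewrite inE.
have p_base (B : {set S}) : p \notin val @: B.
  by apply/imsetP => -[x _ px]; have := adj_p x; rewrite -px adj_irrefl.
have cone_inj : injective cone.
  move=> B C /(congr1 (fun A : {set G} => A :\ p)).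
  by rewrite !setU1K //; apply/imset_inj/val_inj.
rewrite /num_simplices -(card_imset _ cone_inj); apply: eq_card => A.
rewrite inE; apply/andP/imsetP => [[/simplicesP[cardA cliqueA] Ap]|].
  pose B : {set S} := val @^-1: A.
  have AE : A = cone B.
    apply/setP => x; rewrite !inE; have [-> //|/= neq_xp] := eqVneq.
    apply/idP/imsetP => [Ax|[y]]; last by rewrite inE => Ay ->.
    have Sx : x \in [set q | adj p q] by rewrite inE cliqueA // eq_sym.
    by exists (exist _ x Sx); rewrite ?inE.
  exists B => //; apply/simplicesP; split=> [|x y].
    apply: succn_inj; rewrite -cardA AE cardsU1 p_base add1n.
    by rewrite (card_imset _ val_inj).
  by rewrite !inE => Ax Ay neq_xy; apply: cliqueA => //; rewrite (inj_eq val_inj).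
move=> [B /simplicesP[cardB cliqueB] ->]; split; last exact: setU11.
apply/simplicesP; split.
  by rewrite cardsU1 p_base add1n (card_imset _ val_inj) cardB.
move=> x y /setU1P[->|/imsetP[x' Bx ->]] /setU1P[->|/imsetP[y' By ->]].
- by rewrite eqxx.
- by rewrite adj_p.
- by rewrite adj_sym adj_p.
by rewrite (inj_eq val_inj) => /(cliqueB _ _ Bx By).
Qed.

(** Both sides count the pairs of a k-simplex and one of its vertices. *)
Lemma sum_card_star (G : sgraph) (k : nat) :
  (\sum_(p : G) #|star G k p| = num_simplices G k * k.+1)%N.
Proof.
under eq_bigr => p _ do rewrite -sum1dep_card.
rewrite (exchange_big_dep [in simplices G k]) /= => [|p A _ /andP[] //].
rewrite -sum_nat_const; apply: eq_bigr => A GA.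
under eq_bigl => p do rewrite GA.
by rewrite sum1_card; case/simplicesP: GA.
Qed.

(** The bound no longer depends on [p], which allows exchanging this sum with
    the sum over all vertices; the added terms vanish. *)
Lemma curvatureE (G : sgraph) (p : G) :
  curvature p = \sum_(k < #|G|.+1) (-1) ^+ k * (#|star G k p|%:R / k.+1%:R).
Proof.
have le_SG : (#|unit_sphere p| <= #|G|)%N by rewrite card_sig max_card.
rewrite big_ord_recl star0 cards1 expr0 mul1r divr1 /curvature; congr (1 + _).
rewrite big_add1 /= (big_nat_widen _ _ _ _ _ le_SG) big_mkord big_mkcond /=.
apply: eq_bigr => k _; rewrite card_star; case: ltnP => //= le_Sk.
by rewrite num_simplices_eq0 // mul0r mulr0.
Qed.

Theorem mainTheorem1 (G : sgraph) :
  \sum_(p : G) curvature p = (euler_char G)%:~R.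
Proof.
under eq_bigr => p _ do rewrite curvatureE.
(* No simplex has dimension #|G|, so the top term vanishes after summation. *)
rewrite exchange_big big_ord_recr /= /euler_char big_mkord rmorph_sum /=.
have charge k : \sum_(p : G) (-1) ^+ k * (#|star G k p|%:R / k.+1%:R) =
    (-1) ^+ k * (num_simplices G k)%:R :> rat.
  rewrite -mulr_sumr -mulr_suml -natr_sum sum_card_star natrM mulfK //.
  by rewrite Num.Theory.pnatr_eq0.
rewrite charge num_simplices_eq0 // mulr0 addr0.
by apply: eq_bigr => k _; rewrite charge rmorphM rmorphXn rmorphN1.
Qed.
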